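(* For every three integers $\ell$, $k$, and $p$ satisfying $1 \le \ell \le k\le p \le \ell+k$, there exist caterpillars $G_1$ and $G_2$ such that $$\max\{a_1(G_1), a_1(G_2)\}=k, \quad a_1(G_1\cup G_2)=p, \quad \text{and} \quad a_1(G_1)+a_1(G_2)=k + \ell,$$ where $G_1\cup G_2$ denotes the disjoint union of $G_1$ and $G_2$.
   Context: All graphs are finite, simple, and have at least one vertex. A caterpillar is a tree in which a single path is incident to (or contains) every edge. The disjoint union of two (vertex-disjoint) graphs $G$ and $H$ has vertex set $V(G)\cup V(H)$ and edge set $E(G)\cup E(H)$. A clique of a graph $G$ is an inclusion-wise maximal complete subgraph (an isolated vertex is a clique of size 1). The $(a,b)$-monochromatic clique transversal game ($(a,b)$-MCT game) on $G$ is played by Alice and Bob, who alternately take turns: in each of her turns Alice chooses $a$ unplayed vertices and colors them red, and in each of his turns Bob chooses $b$ unplayed vertices and colors them blue (if fewer unplayed vertices remain, the player colors all of them). Alice wins if the red vertices contain at least one vertex of each clique of $G$; Bob wins if all vertices of some clique of $G$ are blue. The game is Alice-start if Alice moves first. The threshold $a_1(G)$ is the smallest positive integer $a$ such that Alice has a winning strategy in the Alice-start $(a,1)$-MCT game on $G$. *)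

(* Defs.v *)
From HB Require Import structures.
From mathcomp Require Import all_boot.

Set Implicit Arguments.
Unset Strict Implicit.
Unset Printing Implicit Defensive.

Record sgraph := SGraph {
  vertex :> finType;
  adj : rel vertex;
  adj_sym : symmetric adj;
  adj_irr : irreflexive adj;
  vertex_gt0 : 0 < #|vertex| }.

Section DisjointUnion.
Variables G H : sgraph.

Definition union_adj (x y : G + H) : bool :=
  match x, y with
  | inl u, inl v => adj u v
  | inr u, inr v => adj u v
  | _, _ => false
  end.

Lemma union_adj_sym : symmetric union_adj.
Proof. by case=> [u|u] [v|v] //=; rewrite adj_sym. Qed.

Lemma union_adj_irr : irreflexive union_adj.
Proof. by case=> u /=; rewrite adj_irr. Qed.

Lemma union_vertex_gt0 : 0 < #|{: G + H}|.
Proof. by rewrite card_sum addn_gt0 vertex_gt0. Qed.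

Definition disjoint_union : sgraph :=
  SGraph union_adj_sym union_adj_irr union_vertex_gt0.
End DisjointUnion.

Section Graph.
Variable G : sgraph.
Implicit Types (C R B M : {set G}).

Definition is_connected : Prop := forall x y : G, connect (@adj G) x y.

(* [ucycle] also accepts the closed walks x, y, x, which are no graph cycles;
   hence the bound on the size. *)
Definition acyclic : Prop :=
  forall c : seq G, 2 < size c -> ~ ucycle (@adj G) c.

Definition is_tree : Prop := is_connected /\ acyclic.

Definition caterpillar : Prop :=
  is_tree /\
  exists (x : G) (s : seq G),
    [/\ path (@adj G) x s, uniq (x :: s)
      & forall u v : G, adj u v -> (u \in x :: s) || (v \in x :: s)].

Definition complete_set C : bool :=
  [forall x in C, forall y in C, (x != y) ==> adj x y].

(* Cliques are inclusion-wise maximal. *)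
Definition clique C : bool := maxset complete_set C.

Definition transversal R : bool :=
  [forall C : {set G}, clique C ==> (R :&: C != set0)].

(* A position is the pair (red vertices, blue vertices). *)
Definition position : finType := ({set G} * {set G})%type.

Definition unplayed (q : position) : {set G} := ~: (q.1 :|: q.2).

Definition legal_move (n : nat) (q : position) M : bool :=
  (M \subset unplayed q) && (#|M| == minn n #|unplayed q|).

(* The game has perfect information and no position with an unplayed vertex
   occurs twice, so strategies may be taken to depend on the position only. *)
Definition strategy := {ffun position -> {set G}}.

Definition legal_strategy (n : nat) (s : strategy) : bool :=
  [forall q, legal_move n q (s q)].

Definition alice_turn (s : strategy) (q : position) : position :=
  (q.1 :|: s q, q.2).

Definition bob_turn (t : strategy) (q : position) : position :=
  (q.1, q.2 :|: t q).

(* As long as some vertex is unplayed, each round plays at least one (if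
   0 < a + b), so #|G| rounds complete the game; further turns are empty. *)
Definition alice_start_outcome (s t : strategy) : position :=
  iter #|G| (fun q => bob_turn t (alice_turn s q)) (set0, set0).

(* When all the vertices are played, Bob owns a whole clique exactly when the
   red set is not a transversal. *)
Definition alice_start_win (a b : nat) : bool :=
  [exists s : strategy, legal_strategy a s &&
    [forall t : strategy, legal_strategy b t ==>
      transversal (alice_start_outcome s t).1]].

Lemma clique_neq0 C : clique C -> C != set0.
Proof.
move=> /maxsetP[_ maxC]; apply/eqP=> C0.
have [x _] := card_gt0P (vertex_gt0 G).
have K1 : complete_set [set x].
  apply/forall_inP=> y /set1P->; apply/forall_inP=> z /set1P->.
  by rewrite eqxx.
have /setP/(_ x) : [set x] = C by apply: maxC; rewrite // C0 sub0set.
by rewrite C0 !inE eqxx.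
Qed.

Lemma alice_start_win_card b : alice_start_win #|G| b.
Proof.
apply/existsP; exists [ffun q => unplayed q]; apply/andP; split.
  apply/forallP=> q; rewrite /legal_move ffunE subxx /=.
  by rewrite (minn_idPr (max_card _)).
apply/forallP=> t; apply/implyP=> _; rewrite /alice_start_outcome.
have := vertex_gt0 G; case: #|G| => // n _.
set f := fun q => _.
have fT : (iter n.+1 f (set0, set0)).1 = setT.
  elim: n => [|n IHn]; first by rewrite /= ffunE /unplayed /= !set0U setC0.
  by rewrite iterS; move: IHn; case: (iter _ _ _) => R B /= ->; rewrite setTU.
rewrite fT; apply/forallP=> C; apply/implyP=> /clique_neq0.
by rewrite setTI.
Qed.

Lemma a1_exists : exists a, (0 < a) && alice_start_win a 1.
Proof. by exists #|G|; rewrite vertex_gt0 alice_start_win_card. Qed.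

Definition a1 : nat := ex_minn a1_exists.
End Graph.

(* Main.v *)
(** In a triangle-free graph without isolated vertices the cliques are the edges,
   so after each move [v] of Bob Alice must colour all the unplayed neighbours
   of [v], and that is all she has to do.  Hence she wins exactly when her first
   [a] vertices can be chosen so that the rest induces a graph of maximum degree
   at most [a].  Take for the caterpillars paths on [k] and [l] vertices with [p]
   pendant leaves at each path vertex.  With fewer than [p] vertices per turn,
   Alice has to hit each of the stars in her first turn, whereas with [p]
   vertices per turn it is enough to take every other vertex of the paths.  So
   the thresholds are [k] and [l], and [p] for the union. *)
Require Import Defs.
From HB Require Import structures.
From mathcomp Require Import all_boot.
From mathcomp Require Import zify.

Set Implicit Arguments.
Unset Strict Implicit.
Unset Printing Implicit Defensive.

(** * Legal strategies and the course of a game *)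

Lemma exists_set_between (T : finType) (A B : {set T}) n :
  A \subset B -> #|A| <= n <= #|B| ->
  exists M : {set T}, [/\ A \subset M, M \subset B & #|M| = n].
Proof.
move=> sAB /andP[leAn lenB]; set s := take (n - #|A|) (enum (B :\: A)).
have sP x : x \in s -> x \in B :\: A by move/mem_take; rewrite mem_enum.
exists (A :|: [set:: s]); split; first exact: subsetUl.
  by rewrite subUset sAB; apply/subsetP=> x; rewrite inE => /sP /setDP[].
rewrite cardsU (_ : A :&: _ = set0); last first.
  apply/setP=> x; rewrite !inE; apply/andP=> -[xA /sP].
  by rewrite !inE xA.
rewrite cards0 subn0 cardsE (card_uniqP _) ?take_uniq ?enum_uniq //.
rewrite size_takel ?subnKC // -cardE cardsD (setIidPr sAB).
by rewrite leq_sub2r.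
Qed.

Section Games.
Variable G : sgraph.
Implicit Types (A B R : {set G}) (q : position G) (s t : strategy G).

Definition nbhd A : {set G} := [set y | [exists x in A, adj x y]].

Definition degree_off R (v : G) : nat := #|[set y | adj v y & y \notin R]|.

Definition triangle_free : Prop :=
  forall x y z : G, adj x y -> adj y z -> ~~ adj x z.

Definition no_isolated : Prop := forall x : G, exists y, adj x y.

(** A turn must have a prescribed size, so a plan [need] only says which vertices matter and is
    padded with arbitrary unplayed ones. In positions where the plan is illegal or too large, any
    legal move serves. *)
Lemma guided_strategy (n : nat) (need : position G -> {set G}) :
  exists2 s, legal_strategy n s &
    forall q, need q \subset unplayed q -> #|need q| <= n -> need q \subset s q.
Proof.
pose good q M := legal_move n q M &&
  ((need q \subset unplayed q) && (#|need q| <= n) ==> (need q \subset M)).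
have goodP q : exists M, good q M.
  pose N := if (need q \subset unplayed q) && (#|need q| <= n) then need q
            else set0.
  have [sN leN] : N \subset unplayed q /\ #|N| <= n.
    by rewrite /N; case: ifP => [/andP[]|]; rewrite ?sub0set ?cards0.
  have := @exists_set_between _ N (unplayed q) (minn n #|unplayed q|) sN.
  rewrite leq_min leN (subset_leq_card sN) geq_minr => /(_ isT)[M [sNM sM cM]].
  exists M; rewrite /good /legal_move sM cM eqxx /=; apply/implyP=> H.
  by move: sNM; rewrite /N H.
exists [ffun q => xchoose (goodP q)].
  by apply/forallP=> q; rewrite ffunE; case/andP: (xchooseP (goodP q)).
move=> q sN leN; rewrite ffunE; case/andP: (xchooseP (goodP q)) => _.
by rewrite sN leN.
Qed.

Lemma legal_strategy_sub n s q : legal_strategy n s -> s q \subset unplayed q.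
Proof. by move/forallP=> /(_ q) /andP[]. Qed.

Lemma legal_strategy_card n s q :
  legal_strategy n s -> #|s q| = minn n #|unplayed q|.
Proof. by move/forallP=> /(_ q) /andP[_ /eqP]. Qed.

Lemma disjoint_unplayed A q :
  A \subset unplayed q -> [disjoint A & q.1] /\ [disjoint A & q.2].
Proof. by rewrite /unplayed setCU subsetI !subsets_disjoint !setCK => /andP[]. Qed.

Definition round s t q := bob_turn t (alice_turn s q).

Lemma round_disjoint a b s t q :
  legal_strategy a s -> legal_strategy b t ->
  [disjoint q.1 & q.2] -> [disjoint (round s t q).1 & (round s t q).2].
Proof.
move=> las lbt dq; have [_ dsB] := disjoint_unplayed (legal_strategy_sub q las).
have [dtR _] := disjoint_unplayed (legal_strategy_sub (alice_turn s q) lbt).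
move: dq dsB dtR; rewrite /= -!setI_eq0 => dq dsB dtR.
by rewrite setIUr setU_eq0 [_ :&: t _]setIC dtR andbT setIUl setU_eq0 dq.
Qed.

Lemma iter_round_disjoint a b s t n q :
  legal_strategy a s -> legal_strategy b t ->
  [disjoint q.1 & q.2] ->
  [disjoint (iter n (round s t) q).1 & (iter n (round s t) q).2].
Proof.
move=> las lbt dq; elim: n => //= n IHn; exact: (round_disjoint las lbt).
Qed.

Lemma iter_round_blue s t n q : q.2 \subset (iter n (round s t) q).2.
Proof.
by elim: n => //= n IHn; apply: subset_trans IHn _; apply: subsetUl.
Qed.

(** Bob's vertex alone accounts for the decrease, so nothing is asked of [a]. *)
Lemma card_unplayed_round a s t q : legal_strategy a s -> legal_strategy 1 t ->
  #|unplayed (round s t q)| <= #|unplayed q|.-1.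
Proof.
move=> las lbt; set q' := alice_turn s q.
have sub : unplayed q' \subset unplayed q.
  by rewrite setCS setUSS ?subsetUl.
have -> : unplayed (round s t q) = unplayed q' :\: t q'.
  by apply/setP=> x; rewrite !inE /=; do ![case: (_ \in _)].
rewrite cardsD (setIidPr (legal_strategy_sub q' lbt)).
rewrite (legal_strategy_card q' lbt).
have := subset_leq_card sub; lia.
Qed.

Lemma unplayed_outcome a s t : legal_strategy a s -> legal_strategy 1 t ->
  unplayed (alice_start_outcome s t) = set0.
Proof.
move=> las lbt; apply/eqP; rewrite -cards_eq0 -leqn0 /alice_start_outcome.
suff: forall n, #|unplayed (iter n (round s t) (set0, set0))| <= #|G| - n.
  by move/(_ #|G|); rewrite subnn.
elim=> [|n IHn]; first by rewrite subn0 max_card.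
rewrite iterS; apply: leq_trans (card_unplayed_round _ las lbt) _; lia.
Qed.

(** * Cliques as edges, and degree criteria for winning and losing *)

Lemma edge_clique (x y : G) : triangle_free -> adj x y -> clique [set x; y].
Proof.
move=> tf xy; apply/maxsetP; split.
  apply/forall_inP=> u /set2P Hu; apply/forall_inP=> v /set2P Hv.
  by case: Hu Hv => -> [] ->; rewrite ?eqxx ?(adj_sym y) ?xy ?implybT.
move=> C /forall_inP cC sC; apply/eqP; rewrite eqEsubset sC andbT.
have xC : x \in C by apply: (subsetP sC); rewrite set21.
have yC : y \in C by apply: (subsetP sC); rewrite set22.
apply/subsetP=> z zC; rewrite !inE; apply/norP=> -[zx zy].
have zadj u : u \in C -> z != u -> adj z u.
  by move=> uC; move/forall_inP: (cC z zC) => /(_ u uC) /implyP.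
by have /negP[] := tf z x y (zadj x xC zx) xy; apply: zadj.
Qed.

(** A single vertex is never maximal here, since it can be enlarged by a neighbour. *)
Lemma clique_edge C : no_isolated -> clique C ->
  exists x y : G, [/\ x \in C, y \in C & adj x y].
Proof.
move=> nis clC; have /set0Pn[x xC] := clique_neq0 clC.
have /maxsetP[/forall_inP cC maxC] := clC; have [y xy] := nis x.
have [Cx|] := boolP (C \subset [set x]).
  exists x, y; split=> //; rewrite -(maxC [set x; y]) ?set22 //.
    apply/forall_inP=> u /set2P Hu; apply/forall_inP=> v /set2P Hv.
    by case: Hu Hv => -> [] ->; rewrite ?eqxx ?(adj_sym y) ?xy ?implybT.
  by apply: subset_trans Cx _; rewrite sub1set set21.
case/subsetPn=> z zC; rewrite inE => zx; exists z, x; split=> //.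
by have /forall_inP/(_ x xC)/implyP := cC z zC; apply.
Qed.

(** Alice starts with [R] and then always takes the unplayed neighbours of the blue vertices. This
    keeps the blue set independent, so in the end every edge has a red endpoint. *)
Lemma alice_start_win_degree a R : no_isolated -> #|R| <= a ->
  (forall v, v \notin R -> degree_off R v <= a) -> alice_start_win G a 1.
Proof.
move=> nis leRa degR.
(* The vertices that Alice has to colour now: those of [R] matter in her first turn, later only the
   neighbours of blue vertices do. *)
pose need q := (R :|: nbhd q.2) :\: (q.1 :|: q.2).
have [s las sP] := guided_strategy a need.
apply/existsP; exists s; rewrite las; apply/forallP=> t; apply/implyP=> lbt.
pose indep (B : {set G}) := forall x y : G, x \in B -> y \in B -> ~~ adj x y.
pose inv q := [/\ [disjoint q.1 & q.2], indep q.2, [disjoint R & q.2]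
                & #|need q| <= a].
have inv_round q : inv q -> inv (round s t q).
  move=> [dq iq dR nq]; set q' := alice_turn s q.
  (* No vertex of this set is blue, because the blue set is independent and avoids [R]. Those not
     yet red form [need q], which fits into one turn. *)
  have Rq' : R :|: nbhd q.2 \subset q'.1.
    apply/subsetP=> x xRN; rewrite inE.
    have [//|xq1 /=] := boolP (x \in q.1).
    have xq2 : x \notin q.2.
      apply/negP=> xq2; move: xRN; rewrite !inE (disjointFl dR xq2) /=.
      by case/existsP=> y /andP[yq2 yx]; have := iq y x yq2 xq2; rewrite yx.
    apply: (subsetP (sP q _ nq)); last first.
      by rewrite in_setD xRN in_setU negb_or xq1 xq2.
    by rewrite /need /unplayed setDE subsetIr.
  have [dtR _] := disjoint_unplayed (legal_strategy_sub q' lbt).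
  have tP v : v \in t q' -> t q' = [set v] /\ v \notin q'.1.
    move=> vt; rewrite (disjointFr dtR vt); split=> //; apply/esym/eqP.
    rewrite eqEcard sub1set vt cards1 (legal_strategy_card q' lbt).
    exact: geq_minl.
  have := round_disjoint las lbt dq; move: Rq' dtR tP.
  rewrite (_ : round s t q = (q'.1, q.2 :|: t q')) // /inv /=.
  move: (q.1 :|: s q) (t q') => R1 T Rq' dTR tP dq1.
  have NB (x y : G) : x \in q.2 -> adj x y -> y \in R1.
    move=> xq2 xy; apply: (subsetP Rq'); rewrite !inE; apply/orP; right.
    by apply/existsP; exists x; rewrite xq2.
  have RR1 x : x \in R -> x \in R1.
    by move=> xR; apply: (subsetP Rq'); rewrite inE xR.
  split=> //.
  - move=> x y; rewrite !in_setU => /orP[xB|xT] /orP[yB|yT].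
    + exact: iq.
    + apply/negP=> xy; have := NB x y xB xy.
      by have [_ /negPf->] := tP y yT.
    + apply/negP; rewrite adj_sym => yx; have := NB y x yB yx.
      by have [_ /negPf->] := tP x xT.
    + have [Tx _] := tP x xT; move: yT; rewrite Tx => /set1P->.
      by rewrite adj_irr.
  - have dRT : [disjoint R & T].
      by rewrite disjoint_sym (disjointWr _ dTR) //; apply/subsetP=> x /RR1.
    by move: dR dRT; rewrite -!setI_eq0 setIUr setU_eq0 => -> ->.
  (* Either Bob had no vertex left to play, or he played a single [v]. All earlier demands are red
     by now, so the new ones are neighbours of [v] outside [R]. *)
  - have [T0|/set0Pn[v vT]] := eqVneq T set0.
      rewrite /need T0 setU0 /= (_ : _ :\: _ = set0) ?cards0 //.
      apply/eqP; rewrite setD_eq0; exact: subset_trans Rq' (subsetUl _ _).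
    have [Tv vR1] := tP v vT.
    have vR : v \notin R by apply: contra vR1; apply: RR1.
    apply: leq_trans (degR v vR); apply: subset_leq_card.
    apply/subsetP=> x; rewrite !inE Tv /= => /andP[/norP[xR1 _]].
    have xR : x \notin R by apply: contra xR1; apply: RR1.
    rewrite xR andbT (negPf xR) /= => /existsP[y].
    rewrite !inE => /andP[/orP[yB yx|/eqP->//]].
    by rewrite (NB y x yB yx) in xR1.
(* At the start [need] is [R] itself, whence the bound on the size of [R]. *)
have [dq iq _ _] : inv (alice_start_outcome s t).
  rewrite /alice_start_outcome; elim: #|G| => [|n IHn]; last exact: inv_round.
  split=> /=; rewrite ?disjoints_subset ?setC0 ?subsetT //.
    by move=> x y; rewrite inE.
  apply: leq_trans leRa; apply: subset_leq_card.
  apply/subsetP=> x; rewrite !inE => /andP[_] /orP[//|/existsP[y]].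
  by rewrite inE.
apply/forallP=> C; apply/implyP=> clC.
have [x [y [xC yC xy]]] := clique_edge nis clC.
have played z : (z \in (alice_start_outcome s t).1)
             || (z \in (alice_start_outcome s t).2).
  have /setP/(_ z) := unplayed_outcome las lbt.
  by rewrite !inE => /negbFE.
apply/set0Pn; have := iq x y; rewrite xy.
case/orP: (played x) => [xr _|xb]; first by exists x; rewrite inE xr.
case/orP: (played y) => [yr _|yb]; first by exists y; rewrite inE yr.
by move/(_ xb yb).
Qed.

(** Bob first takes a vertex with more than [a] unplayed neighbours. Alice cannot take all of them
    in one turn, so Bob then completes a blue edge, which is a clique since there are no
    triangles. *)
Lemma alice_start_lose_degree a : triangle_free ->
  (forall R, #|R| <= a -> exists2 v, v \notin R & a < degree_off R v) ->
  ~~ alice_start_win G a 1.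
Proof.
move=> tf degP.
pose threat q w := (w \in unplayed q) && (w \in nbhd q.2).
pose big q v := (v \in unplayed q) && (a < #|unplayed q :&: nbhd [set v]|).
(* Completing a blue edge has priority over preparing one. *)
pose need q := if [pick w | threat q w] is Some w then [set w]
               else if [pick v | big q v] is Some v then [set v] else set0.
have [t lbt tP] := guided_strategy 1 need.
apply/existsP=> -[s /andP[las /forallP/(_ t)]]; rewrite lbt /=; apply/negP.
have nbhd1 (v w : G) : (w \in nbhd [set v]) = adj v w.
  rewrite inE; apply/existsP/idP=> [[x]|vw]; first by case/andP=> /set1P->.
  by exists v; rewrite set11.
have tE q w : need q = [set w] -> w \in unplayed q -> t q = [set w].
  move=> nq wq; have := tP q; rewrite nq cards1 sub1set wq => /(_ isT isT) sw.
  apply/esym/eqP; rewrite eqEcard sw cards1 (legal_strategy_card q lbt).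
  exact: geq_minl.
set q1 := alice_turn s (set0, set0).
have [v bv tv] : exists2 v, big q1 v & t q1 = [set v].
  have [|v vR degv] := degP (s (set0, set0)).
    by rewrite (legal_strategy_card _ las) geq_minl.
  have bv : big q1 v.
    rewrite /big !inE (negPf vR) /=; apply: leq_trans degv _.
    apply: subset_leq_card; apply/subsetP=> y.
    by rewrite in_setI nbhd1 !inE orbF => /andP[-> ->].
  (* Nothing is blue before Bob's first turn, so he falls back on a vertex of large degree. *)
  have nt w : threat q1 w = false.
    apply/negP; rewrite /threat => /andP[_]; rewrite inE => /existsP[x].
    by rewrite inE.
  have nE : need q1 = if [pick v | big q1 v] is Some v then [set v] else set0.
    by rewrite /need; case: pickP => // w; rewrite nt.
  move: nE; case: pickP => [v' bv' nE|/(_ v)]; last by rewrite bv.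
  exists v'=> //; apply: tE => //; by case/andP: bv'.
set q2 := round s t (set0, set0).
have q2b : q2.2 = [set v] by rewrite /= -/q1 tv set0U.
set q3 := alice_turn s q2.
have [w] : exists w, threat q3 w.
  have /andP[_ degv] := bv.
  have : ~~ (unplayed q1 :&: nbhd [set v] \subset s q2).
    apply/negP=> /subset_leq_card; rewrite (legal_strategy_card _ las).
    by move/(leq_trans degv); rewrite leq_min ltnn.
  case/subsetPn=> w; rewrite inE nbhd1 => /andP[wu vw] ws; exists w.
  rewrite /threat [q3.2]q2b nbhd1 vw andbT inE in_setU [q3.2]q2b negb_or in_setU.
  rewrite (negPf ws) orbF inE; move: wu; rewrite !inE negb_or => /andP[-> _].
  by apply: contraTneq vw => ->; rewrite adj_irr.
move=> tw; have [w' tw' nE] : exists2 w, threat q3 w & need q3 = [set w].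
  rewrite /need; case: pickP => [w' tw'|/(_ w)]; last by rewrite tw.
  by exists w'.
have [w'u w'v] := andP tw'.
have vw' : adj v w' by move: w'v; rewrite [q3.2]q2b nbhd1.
set q4 := round s t q2.
have q4b : [set v; w'] \subset q4.2.
  by rewrite (_ : q4.2 = q2.2 :|: t q3) // q2b (tE _ _ nE w'u).
(* The outcome is defined by [#|G|] rounds, and the two rounds analysed above must be among them.
   The later ones keep the blue edge blue and disjoint from the red set. *)
have : 1 < #|G|.
  apply: leq_trans (max_card (pred2 v w')); rewrite card2.
  by case: eqVneq vw' => // ->; rewrite adj_irr.
rewrite /transversal negb_forall /alice_start_outcome => G2.
apply/existsP; exists [set v; w']; rewrite negb_imply edge_clique //= negbK.
case: #|G| G2 => [|[|n]] // _; rewrite !iterSr -/(round s t _) -/q2 -/(round s t _).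
rewrite -/q4 setI_eq0.
apply: (disjointWr (subset_trans q4b (iter_round_blue s t n q4))).
apply: (iter_round_disjoint _ las lbt); do 2!apply: (round_disjoint las lbt).
by rewrite disjoints_subset sub0set.
Qed.

(* By pigeonhole, one of the [#|T|] disjoint stars is missed by Alice's first
   turn. *)
Lemma alice_start_lose_stars (T : finType) (g : G -> T) (c : T -> G) a :
  triangle_free -> cancel c g -> a < #|T| ->
  (forall i, a < #|[set y | adj (c i) y & g y == i]|) ->
  ~~ alice_start_win G a 1.
Proof.
move=> tf cK aT degc; apply: alice_start_lose_degree => // R leRa.
have : ~~ ([set: T] \subset g @: R).
  apply/negP=> /subset_leq_card; rewrite cardsT => /(leq_trans aT).
  by move/leq_trans/(_ (leq_imset_card _ _)); rewrite ltnNge leRa.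
case/subsetPn=> i _ iR; exists (c i).
  by apply: contra iR => ciR; rewrite -(cK i) imset_f.
apply: leq_trans (degc i) _; apply: subset_leq_card; apply/subsetP=> y.
rewrite !inE => /andP[-> /eqP gy]; apply: contra iR => yR.
by rewrite -gy imset_f.
Qed.

Lemma a1_eq m : 0 < m -> alice_start_win G m 1 ->
  (forall a, a < m -> ~~ alice_start_win G a 1) -> a1 G = m.
Proof.
move=> m0 wm lm; rewrite /a1; case: ex_minnP => n /andP[n0 wn] minn.
apply/eqP; rewrite eqn_leq minn ?m0 //= leqNgt.
by apply: contraL wn => /lm.
Qed.

(** * Recognising trees by a rank function *)

(** On a cycle, a vertex of highest rank has two distinct neighbours, both of lower rank, and both
    would have to be its parent. *)
Lemma acyclic_rank (rank : G -> nat) (par : G -> G) :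
  (forall x y : G, adj x y -> rank x != rank y) ->
  (forall x y : G, adj x y -> rank y < rank x -> y = par x) -> acyclic G.
Proof.
move=> rk parP c c2 /andP[cyc unc].
have [x0 x0c] : exists x, x \in c
  by case: c c2 {cyc unc} => // x; exists x; rewrite mem_head.
have [x xc maxx] := @arg_maxnP _ x0 (mem c) rank x0c.
have [i c' defc] := rot_to xc.
have max' y : y \in c' -> rank y <= rank x.
  by move=> yc'; apply: maxx; rewrite /= -(mem_rot i) defc inE yc' orbT.
have lower y : y \in c' -> adj x y -> y = par x.
  move=> yc' xy; apply: parP => //; rewrite ltn_neqAle max' // andbT eq_sym.
  exact: rk.
(* Once the cycle is rotated to begin at [x], the two neighbours are its second and its last
   entry. *)
move: c2 cyc unc; rewrite -(size_rot i) -(rot_cycle i) -(rot_uniq i) defc.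
case: c' lower {max' defc} => [|y [|z c']] // lower _ /=.
rewrite rcons_path => /and3P[xy _ /andP[_]].
rewrite adj_sym => /lower; rewrite inE mem_last orbT => /(_ isT) lE.
by rewrite (lower y) ?mem_head // -lE mem_last andbF.
Qed.

Lemma connected_rank (r : G) (rank : G -> nat) (par : G -> G) :
  (forall x, x != r -> adj (par x) x /\ rank (par x) < rank x) -> is_connected G.
Proof.
move=> parP; have sym : connect_sym (@adj G).
  by apply: sym_connect_sym; apply: adj_sym.
suff rP x : connect (@adj G) r x.
  by move=> x y; apply: connect_trans (rP y); rewrite sym.
have [n] := ubnP (rank x); elim: n x => // n IHn x /ltnSE xn.
have [->//|/parP[px lt]] := eqVneq x r.
apply: connect_trans (connect1 px); apply: IHn; exact: leq_trans lt xn.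
Qed.

Lemma acyclic_triangle_free : acyclic G -> triangle_free.
Proof.
move=> acy x y z xy yz; apply/negP=> xz; apply: (acy [:: x; y; z]) => //.
have ne (u v : G) : adj u v -> u != v by apply: contraTneq => ->; rewrite adj_irr.
by rewrite /ucycle /= xy yz adj_sym xz !inE negb_or !ne.
Qed.
End Games.

(** * The game on a disjoint union *)

Section Union.
Variables G H : sgraph.
Local Notation GH := (disjoint_union G H).

Lemma union_no_isolated : no_isolated G -> no_isolated H -> no_isolated GH.
Proof.
move=> nG nH [x|x]; first by have [y xy] := nG x; exists (inl y).
by have [y xy] := nH x; exists (inr y).
Qed.

Lemma union_triangle_free : triangle_free G -> triangle_free H -> triangle_free GH.
Proof. by move=> tG tH [x|x] [y|y] [z|z] //=; [apply: tG | apply: tH]. Qed.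

Lemma union_degree_off (R : {set G}) (S : {set H}) (v : GH) :
  degree_off (inl @: R :|: inr @: S : {set GH}) v =
    match v with inl x => degree_off R x | inr x => degree_off S x end.
Proof.
have inlR x : ((inl x : GH) \in inl @: R :|: inr @: S) = (x \in R).
  rewrite in_setU mem_imset; last by move=> ? ? [].
  by rewrite orbC; case: imsetP => // -[].
have inrS x : ((inr x : GH) \in inl @: R :|: inr @: S) = (x \in S).
  rewrite in_setU (mem_imset S); last by move=> ? ? [].
  by case: imsetP => // -[].
case: v => x; rewrite /degree_off.
  rewrite -(@card_imset _ _ (@inl G H)); last by move=> ? ? [].
  apply: eq_card => -[y|y]; rewrite in_set ?inlR ?inrS.
    by rewrite mem_imset ?inE // => ? ? [].
  by symmetry; apply/imsetP=> -[].
rewrite -(@card_imset _ _ (@inr G H)); last by move=> ? ? [].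
apply: eq_card => -[y|y]; rewrite in_set ?inlR ?inrS.
  by symmetry; apply/imsetP=> -[].
by rewrite mem_imset ?inE // => ? ? [].
Qed.

(** The two opening sets share Alice's first turn, so their sizes add up. The degree bounds do not,
    since the neighbours of a vertex lie in its own component. *)
Lemma union_alice_start_win a (R : {set G}) (S : {set H}) :
  no_isolated G -> no_isolated H -> #|R| + #|S| <= a ->
  (forall v, v \notin R -> degree_off R v <= a) ->
  (forall v, v \notin S -> degree_off S v <= a) ->
  alice_start_win GH a 1.
Proof.
move=> nG nH leRS dR dS.
apply: (@alice_start_win_degree GH a (inl @: R :|: inr @: S)).
- exact: union_no_isolated.
- apply: leq_trans (leq_trans (leq_card_setU _ _) _) leRS.
  by rewrite leq_add ?leq_imset_card.
- move=> [v|v] vR; rewrite union_degree_off; [apply: dR|apply: dS];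
    by apply: contra vR => vR; rewrite in_setU imset_f ?orbT.
Qed.

(** The pigeonhole argument runs over the stars of both components together, indexed by [T + U]. *)
Lemma union_alice_start_lose (T U : finType) (g : G -> T) (c : T -> G)
    (h : H -> U) (d : U -> H) a :
  triangle_free G -> triangle_free H -> cancel c g -> cancel d h ->
  a < #|T| + #|U| ->
  (forall i, a < #|[set y | adj (c i) y & g y == i]|) ->
  (forall j, a < #|[set y | adj (d j) y & h y == j]|) ->
  ~~ alice_start_win GH a 1.
Proof.
move=> tG tH cK dK aTU degc degd.
pose gh (x : GH) : T + U := match x with inl x => inl (g x) | inr x => inr (h x) end.
pose cd (i : T + U) : GH := match i with inl i => inl (c i) | inr i => inr (d i) end.
apply: (@alice_start_lose_stars GH _ gh cd).
- exact: union_triangle_free.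
- by move=> [i|i] /=; rewrite ?cK ?dK.
- by rewrite card_sum.
- case=> i; [apply: leq_trans (degc i) _|apply: leq_trans (degd i) _].
    rewrite -(@card_imset _ _ (@inl G H)); last by move=> ? ? [].
    apply: subset_leq_card; apply/subsetP=> _ /imsetP[y + ->].
    by rewrite !inE.
  rewrite -(@card_imset _ _ (@inr G H)); last by move=> ? ? [].
  apply: subset_leq_card; apply/subsetP=> _ /imsetP[y + ->].
  by rewrite !inE.
Qed.
End Union.

(** * Paths with pendant leaves and their thresholds *)

Section Comb.
Variables n p : nat.
Local Notation V := ('I_n.+1 * option 'I_p)%type.

Definition comb_adj (x y : V) : bool :=
  match x.2, y.2 with
  | None, None => (x.1.+1 == y.1) || (y.1.+1 == x.1)
  | Some _, Some _ => false
  | _, _ => x.1 == y.1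
  end.

Lemma comb_adj_sym : symmetric comb_adj.
Proof. by case=> i [u|] [j [v|]] //=; rewrite /comb_adj /= 1?eq_sym // orbC. Qed.

Lemma comb_adj_irr : irreflexive comb_adj.
Proof. by case=> i [u|] //=; rewrite /comb_adj /= orbb; lia. Qed.

Lemma comb_vertex_gt0 : 0 < #|{: V}|.
Proof. by apply/card_gt0P; exists (ord0, None). Qed.

(* The path consists of the [n.+1] vertices [(i, None)]; the leaves at
   [(i, None)] are the [(i, Some j)]. *)
Definition comb : sgraph := SGraph comb_adj_sym comb_adj_irr comb_vertex_gt0.

Definition spine (i : 'I_n.+1) : comb := (i, None).

(** The distance from the end [spine ord0] of the path, taken as the root. *)
Definition comb_rank (x : comb) : nat := if x.2 is Some _ then x.1.+1 else x.1.

(** The truncated predecessor makes the root its own parent. This is harmless, as parents are only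
    asked for away from the root or towards a vertex of smaller rank. *)
Definition comb_parent (x : comb) : comb :=
  if x.2 is Some _ then spine x.1 else spine (inord x.1.-1).

Lemma comb_tree : is_tree comb.
Proof.
split.
  apply: (@connected_rank comb (spine ord0) comb_rank comb_parent) => -[i [u|]].
    by move=> _; rewrite /= /comb_adj /comb_rank /=.
  move=> ri; have i0 : 0 < i.
    rewrite lt0n; apply: contra ri => i0; apply/eqP; congr (_, _).
    exact/val_inj/eqP.
  have lti := ltn_ord i.
  by rewrite /= /comb_adj /comb_rank /= inordK; lia.
apply: (@acyclic_rank comb comb_rank comb_parent) => -[i [u|]] [j [v|]] //=;
  rewrite /comb_adj /comb_rank /comb_parent //=.
- by move/eqP->; rewrite neq_ltn ltnSn orbT.
- by move/eqP->; rewrite neq_ltn ltnSn.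
- lia.
- by move/eqP->.
- by move/eqP->; rewrite ltnNge leqnSn.
- case/orP=> /eqP ij; rewrite -ij ?(ltnNge, leqW) // => _.
  by congr (_, _); rewrite -[LHS]inord_val.
Qed.

Lemma comb_caterpillar : caterpillar comb.
Proof.
split; first exact: comb_tree.
pose f m : comb := spine (inord m).
(* The whole path is the image of one [iota] from 0, while the definition of a caterpillar wants its
   first vertex split off. *)
have fE : f 0 :: map f (iota 1 n) = map f (iota 0 n.+1) by [].
exists (f 0), (map f (iota 1 n)); split.
- rewrite path_map; apply/(pathP 0) => i; rewrite size_iota => ltin.
  rewrite -/(iota 0 n.+1) !nth_iota ?(leqW ltin) //= /comb_adj /=.
  by rewrite !inordK ?add0n ?add1n ?eqxx // ltnS ltnW.
- rewrite fE map_inj_in_uniq ?iota_uniq // => i j.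
  rewrite !mem_iota !add0n /= => ltin ltjn [/(congr1 val)] /=.
  by rewrite !inordK.
(* Two leaves are never adjacent, so it suffices that the path contains every spine vertex. *)
- have sp i : spine i \in f 0 :: map f (iota 1 n).
    rewrite fE; apply/mapP; exists (val i); first by rewrite mem_iota add0n ltn_ord.
    by rewrite /f inord_val.
  by case=> i [u|] [j [v|]] // _; rewrite ?sp ?orbT.
Qed.

Lemma comb_no_isolated : 0 < p -> no_isolated comb.
Proof.
move=> p0 [i [u|]]; first by exists (spine i); apply: eqxx.
by exists ((i, Some (Ordinal p0)) : comb); apply: eqxx.
Qed.

Lemma comb_triangle_free : triangle_free comb.
Proof. by apply: acyclic_triangle_free; have [] := comb_tree. Qed.

(** The condition on [y.1] discards the neighbours along the path, which makes the stars of
    different spine vertices disjoint while keeping all [p] leaves. *)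
Lemma comb_star (i : 'I_n.+1) :
  p <= #|[set y : comb | adj (spine i) y & y.1 == i]|.
Proof.
rewrite -{1}[p]card_ord -(@card_codom _ _ (fun u : 'I_p => (i, Some u) : comb)).
  apply: subset_leq_card; apply/subsetP=> _ /codomP[u ->].
  by rewrite inE /= /comb_adj /= !eqxx.
by move=> u v [].
Qed.

Lemma spine_degree_off (v : comb) :
  v \notin spine @: setT -> degree_off (spine @: setT) v = 0.
Proof.
have sp i : (i, None) \in spine @: setT by apply: imset_f.
case: v => i [u|]; last by rewrite sp.
move=> _; apply/eqP; rewrite cards_eq0; apply/eqP/setP=> -[j [w|]].
  by rewrite !inE.
by rewrite inE sp andbF inE.
Qed.

(** Alice's opening set when she has [p] vertices per turn. Choosing the odd indices rounds half the
    length of the path down. *)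
Definition odd_spine : {set comb} := spine @: [set i : 'I_n.+1 | odd i].

Lemma card_odd_spine : #|odd_spine| = n.+1./2.
Proof.
rewrite card_imset; last by move=> i j [].
rewrite -sum1_card big_mkcond (eq_bigr (fun i : 'I_n.+1 => odd i : nat)).
  elim: n.+1 => [|m IHm]; first by rewrite big_ord0.
  by rewrite big_ord_recr /= IHm; lia.
by move=> i _; rewrite inE; case: odd.
Qed.

(** What remains is a disjoint union of stars and isolated leaves: the path neighbours of an even
    spine vertex are odd, so it keeps only its [p] leaves, and a leaf keeps at most one
    neighbour. *)
Lemma odd_spine_degree_off (v : comb) :
  0 < p -> v \notin odd_spine -> degree_off odd_spine v <= p.
Proof.
have spE (i : 'I_n.+1) : ((i, None) \in odd_spine) = odd i.
  rewrite (mem_imset [set i : 'I_n.+1 | odd i] i); last by move=> ? ? [].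
  by rewrite inE.
case: v => i [u|] p0.
  move=> _; apply: leq_trans p0; rewrite -(cards1 (spine i)).
  apply: subset_leq_card; apply/subsetP=> -[j [w|]]; rewrite !inE //.
  by case/andP=> /eqP /= ->.
rewrite spE => evi; rewrite -[leqRHS]card_ord.
rewrite -cardsT -(@card_imset _ _ (fun u : 'I_p => (i, Some u) : comb));
  last by move=> ? ? [].
apply: subset_leq_card; apply/subsetP=> -[j [w|]]; rewrite inE.
  by case/andP=> /eqP /= -> _; apply: imset_f.
rewrite spE /= /comb_adj /=; lia.
Qed.

(** Opening with the whole spine leaves no edge. With [a] at most [n] there are more stars than
    Alice has vertices in a turn, and each has [p > a] leaves. *)
Lemma a1_comb : n < p -> a1 comb = n.+1.
Proof.
move=> ltnp; have p0 : 0 < p by apply: leq_ltn_trans ltnp.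
apply: a1_eq => // [|a ltan].
  apply: (@alice_start_win_degree comb _ (spine @: setT)).
  - exact: comb_no_isolated.
  - by rewrite (leq_trans (leq_imset_card _ _)) // cardsT card_ord.
  - by move=> v /spine_degree_off->.
apply: (@alice_start_lose_stars comb _ fst spine) => //.
- exact: comb_triangle_free.
- by rewrite card_ord.
- move=> i; apply: leq_trans (comb_star i); lia.
Qed.
End Comb.

(** * The threshold of the union, and the theorem *)

Lemma a1_union_comb n m p : n < p -> m < p -> p <= n.+1 + m.+1 ->
  a1 (disjoint_union (comb n p) (comb m p)) = p.
Proof.
move=> ltnp ltmp lep; have p0 : 0 < p by apply: leq_ltn_trans ltnp.
apply: a1_eq => // [|a ltap].
  apply: (@union_alice_start_win _ _ _ (odd_spine n p) (odd_spine m p)).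
  1,2: exact: comb_no_isolated.
  (* Both paths have at most [p] vertices, so the two halves, rounded down, sum to at most [p]. *)
  - by rewrite !card_odd_spine; lia.
  1,2: by move=> v; apply: odd_spine_degree_off.
apply: (@union_alice_start_lose (comb n p) (comb m p) _ _
          fst (@spine n p) fst (@spine m p)) => //.
1,2: exact: comb_triangle_free.
(* The union has [n.+1 + m.+1] stars, at least [p] and hence more than [a]. *)
- by rewrite !card_ord; lia.
all: by move=> i; apply: leq_trans ltap (comb_star _ i).
Qed.

Theorem corollary3p4 (l k p : nat) (l_ge1 : 1 <= l) (le_lk : l <= k)
    (le_kp : k <= p) (le_plk : p <= l + k) :
  exists G1 G2 : sgraph,
    [/\ caterpillar G1, caterpillar G2,
        maxn (a1 G1) (a1 G2) = k,
        a1 (disjoint_union G1 G2) = p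
      & a1 G1 + a1 G2 = k + l].
Proof.
have k_ge1 := leq_trans l_ge1 le_lk.
(* The first parameter of [comb] is one less than the number of path vertices, so the paths have [k]
   and [l] vertices. *)
exists (comb k.-1 p), (comb l.-1 p); split; try exact: comb_caterpillar.
- by rewrite !a1_comb ?prednK //; lia.
- by rewrite a1_union_comb ?prednK //; lia.
- by rewrite !a1_comb ?prednK //; lia.
Qed.
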